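(* Let $(G,S)$ be a Cayley graph of a group of polynomial growth with homogeneous dimension $N\geq3$, and write $p^{\ast\ast}:=\frac{Np}{N-2p}$. For every $1<p<\frac N2$ there is a constant $C_p$ such that $$\lVert u\rVert_{\ell^{p^{\ast\ast}}(G)}\le C_p\lVert u\rVert_{D^{2,p}(G)}\qquad\text{for all }u\in D_0^{2,p}(G),$$ and for every $1\le p<\frac N2$ there is a constant $C_p$ such that $$\lVert u\rVert_{\ell^{p^{\ast\ast}}(G)}\le C_p\lVert u\rVert_{\widetilde D^{2,p}(G)}\qquad\text{for all }u\in\widetilde D_0^{2,p}(G).$$
   Context: $G$ is a finitely generated group and $S=\{s_1,\dots,s_m\}$ a finite generating set with $S=S^{-1}$. The Cayley graph $(G,S)$ has vertex set $G$, and $x\sim y$ iff $x=ys$ for some $s\in S$. $\beta_S(n)$ is the number of elements of $G$ at word distance at most $n$ from the unit element. $G$ is of polynomial growth with homogeneous dimension $N\in\mathbb N$ if there are constants $C_1,C_2>0$ depending on $S$ with $C_1n^N\le\beta_S(n)\le C_2n^N$ for all $n\ge1$. For $u:G\to\mathbb R$: $\Delta u(x):=\sum_{y\sim x}(u(y)-u(x))$, $\partial_iu(x):=u(xs_i)-u(x)$, $\lVert u\rVert_{D^{2,p}(G)}:=\lVert\Delta u\rVert_{\ell^p(G)}$, $\lVert u\rVert_{\widetilde D^{2,p}(G)}:=\left(\sum_{i,j=1}^m\sum_{x\in G}|\partial_j\partial_iu(x)|^p\right)^{1/p}$. $C_0(G)$ is the space of finitely supported functions; $D_0^{2,p}(G)$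 and $\widetilde D_0^{2,p}(G)$ are the completions of $C_0(G)$ in the norms $\lVert\cdot\rVert_{D^{2,p}(G)}$ and $\lVert\cdot\rVert_{\widetilde D^{2,p}(G)}$ respectively. Elements of a completion are regarded as functions on $G$, a Cauchy sequence in $C_0(G)$ being identified with its pointwise limit. The constants $C_p$ may depend on $p$, $N$, $G$ and $S$ but not on $u$. *)

(* Defs.v *)
From HB Require Import structures.
From mathcomp Require Import all_boot all_order all_algebra finmap.
From mathcomp Require Import all_classical all_reals all_analysis.

Set Implicit Arguments.
Unset Strict Implicit.
Unset Printing Implicit Defensive.

Import Order.TTheory GRing.Theory Num.Theory.
Import numFieldNormedType.Exports.

Local Open Scope classical_set_scope.
Local Open Scope ring_scope.

Section CayleyGraph.
Context (G : groupType) (m : nat) (S : m.-tuple G).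

Definition is_word (n : nat) (g : G) : Prop :=
  exists w : n.-tuple G,
    {subset w <= S} /\ g = (\prod_(s <- w) s)%g.

Definition symmetric_set : Prop := forall s : G, s \in S -> (s^-1)%g \in S.

(* Words in S suffice (no inverses of letters) because S is used only
   together with symmetric_set. *)
Definition generating_set : Prop := forall g : G, exists n, is_word n g.

Definition cayley_adj (x y : G) : Prop := exists2 s, s \in S & x = (y * s)%g.

Definition word_distance1 (g : G) (n : nat) : Prop :=
  is_word n g /\ forall k, is_word k g -> (n <= k)%N.

Definition word_ball (n : nat) : set G :=
  [set g | exists2 k, (k <= n)%N & word_distance1 g k].

(* The balls are finite, so fset_set is not applied to an infinite set. *)
Definition growth (n : nat) : nat := #|` fset_set (word_ball n)|%fset.

Definition polynomial_growth (R : realType) (N : nat) : Prop :=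
  exists C1 C2 : R, [/\ 0 < C1, 0 < C2 &
    forall n : nat, (1 <= n)%N ->
      C1 * n%:R ^+ N <= (growth n)%:R <= C2 * n%:R ^+ N].

Context (R : realType).
Implicit Types (u : G -> R) (p : R).

(* The sum runs over the set of neighbours, which is finite. *)
Definition laplacian u (x : G) : R :=
  \sum_(y \in [set y | cayley_adj y x]) (u y - u x).

Definition partial_diff (i : 'I_m) u (x : G) : R :=
  u (x * tnth S i)%g - u x.

(* Norms take values in \bar R, the value +oo meaning divergence. *)
Definition lp_norm p u : \bar R :=
  ((\esum_(x in [set: G]) (`|u x| `^ p)%:E) `^ p^-1)%E.

Definition D2_norm p u : \bar R := lp_norm p (laplacian u).

Definition tildeD2_norm p u : \bar R :=
  ((\sum_(i < m) \sum_(j < m)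
     \esum_(x in [set: G])
       (`|partial_diff j (partial_diff i u) x| `^ p)%:E) `^ p^-1)%E.

Definition finitely_supported u : Prop := finite_set [set x | u x != 0].

Definition cauchy_for (nrm : (G -> R) -> \bar R) (v : nat -> G -> R) : Prop :=
  forall e : R, 0 < e -> exists n0 : nat, forall i j : nat,
    (n0 <= i)%N -> (n0 <= j)%N -> (nrm (v i \- v j)%R < e%:E)%E.

(* Completion of the finitely supported functions for nrm, realised as a set
   of functions on G through pointwise limits of Cauchy sequences. *)
Definition completion0 (nrm : (G -> R) -> \bar R) : set (G -> R) :=
  [set u | exists v : nat -> G -> R,
    [/\ forall n, finitely_supported (v n),
        cauchy_for nrm v &
        forall x : G, v n x @[n --> \oo] --> u x]].

Definition D20 p : set (G -> R) := completion0 (D2_norm p).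

Definition tildeD20 p : set (G -> R) := completion0 (tildeD2_norm p).

End CayleyGraph.

Arguments lp_norm {G R}.
Arguments finitely_supported {G R}.

Definition sobolev_exp2 (R : realType) (N : nat) (p : R) : R :=
  N%:R * p / (N%:R - 2 * p).

(* Main.v *)
Require Import Defs.
From HB Require Import structures.
From mathcomp Require Import all_boot all_order all_algebra finmap.
From mathcomp Require Import all_classical all_reals all_analysis.
From mathcomp Require Import ring lra.

Set Implicit Arguments.
Unset Strict Implicit.
Unset Printing Implicit Defensive.

Import Order.TTheory GRing.Theory Num.Theory.
Import numFieldNormedType.Exports.

Local Open Scope classical_set_scope.
Local Open Scope ring_scope.

(** Both inequalities come from one geometric input, the isoperimetric
    inequality for the Cayley graph, and from elementary convexity.

    Isoperimetry.  Write grad f for the l^1 norm of the gradient of f.  If F is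
    a finite set and the ball of radius r has at least 2|F| elements, then
    averaging the indicator of F over right translates by the elements of the
    ball loses at least half of its mass on F, whereas translating by a word
    of length at most r moves an l^1 function by at most r grad.  Hence
    |F| <= 2 r grad(1_F) ([card_le_radius_perimeter]).  By the volume growth
    one may take r of order |F|^(1/N), and so |F|^(1-1/N) <= K grad(1_F)
    ([isoperimetric_inequality]).

    First order.  Peeling a nonnegative function into its level sets turns
    this into sum f h <= K |h|_N grad f for every h >= 0 ([layer_cake_bound]
    and Hoelder on sets).  With q = Np/(N-p), f = |v|^(q(1-1/N)) and
    h = |v|^(q/N), the left side is the sum of |v|^q and the gradient of the
    power is controlled by Hoelder; this is the l^p Sobolev inequality
    |v|_q <= K |grad v|_p for 1 <= p < N ([sobolev]).

    Second order, full Hessian.  Apply the l^p inequality to each partial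
    difference and the l^q inequality to the function itself: the exponent of
    the second application is exactly p** ([hessian_bound]).

    Second order, Laplacian.  Let q = p** and s = p(N-2)/(N-2p), which exceeds
    1 precisely because p > 1.  The l^2 Sobolev inequality for |u|^(s/2), the
    Stroock-Varopoulos inequality (which bounds the Dirichlet energy of
    |u|^(s/2) by the Dirichlet form of u and sgn(u)|u|^(s-1)), summation by
    parts and Hoelder give
      |u|_q^s <= C <-Delta u, sgn(u)|u|^(s-1)> <= C |Delta u|_p |u|_q^(s-1),
    and |u|_q^(s-1), finite when u has finite support, cancels
    ([laplacian_bound]).

    Completions.  The norms are l^p norms of finitely many local linear
    operators applied to u.  A Fatou argument on finite sets carries the bounds
    from finitely supported functions to pointwise limits of Cauchy sequences
    ([bound_on_completion]). *)

(** * Real powers and the finite Hoelder inequality *)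

Section PowerInequalities.
Context {R : realType}.
Implicit Types a b r s : R.

Lemma powRVK a r : r != 0 -> 0 <= a -> (a `^ r^-1) `^ r = a.
Proof. by move=> r0 a0; rewrite -powRrM mulVf// powRr1. Qed.

(** Moves an exponent across an inequality; norms are thus compared through
    their powers. *)
Lemma powR_inv_le a b r : 0 < r -> 0 <= a -> 0 <= b ->
  (a `^ r^-1 <= b) = (a <= b `^ r).
Proof.
move=> r0 a0 b0; have rn0 := lt0r_neq0 r0; apply/idP/idP => H.
  rewrite -[leLHS](powRVK rn0 a0).
  by apply: (ge0_ler_powR (ltW r0)); rewrite ?nnegrE ?powR_ge0.
rewrite -[leRHS](powRVK (r := r^-1)) ?invr_eq0// invrK.
by apply: ge0_ler_powR; rewrite ?nnegrE ?powR_ge0 ?invr_ge0 ?(ltW r0).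
Qed.

(** For r <= 1 this is a <= a^r; for r > 1 it is Bernoulli's inequality,
    obtained here from Young's inequality for the product a * 1. *)
Lemma powR_lower_bound a r : 0 <= a -> a <= 1 -> 0 <= r ->
  1 - a `^ r <= (1 + r) * (1 - a).
Proof.
move=> a0 a1 r0.
have [r1|r1] := leP r 1.
  have : a <= a `^ r.
    move: a0; rewrite le_eqVlt => /predU1P[<-|a0]; first exact: powR_ge0.
    by apply: ger1_powR => //; rewrite a0.
  have : 0 <= r * (1 - a) by rewrite mulr_ge0// subr_ge0.
  lra.
have rgt0 : 0 < r by lra.
have q0 : 0 < (1 - r^-1)^-1 by rewrite invr_gt0 subr_gt0 invf_lt1.
have conj : r^-1 + (1 - r^-1)^-1^-1 = 1 by rewrite invrK; lra.
have := conjugate_powR a0 ler01 rgt0 q0 conj.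
rewrite powR1 invrK mulr1 mul1r => H.
have : r * a <= r * (a `^ r / r + (1 - r^-1)) by rewrite ler_pM2l.
rewrite mulrDr mulrCA divff ?gt_eqF// mulr1 mulrBr mulr1 divff ?gt_eqF//.
lra.
Qed.

(** A mean value inequality with a non-optimal constant.  The factor is a^(r-1)
    at the larger endpoint even when r < 1, where the derivative is largest at
    the smaller one: homogeneity reduces it to a = 1. *)
Lemma powR_sub_le a b r : 0 <= b -> b <= a -> 0 < a -> 0 <= r ->
  a `^ r - b `^ r <= (1 + r) * (a `^ (r - 1) * (a - b)).
Proof.
move=> b0 ba a0 r0.
have ba1 : b / a <= 1 by rewrite ler_pdivrMr// mul1r.
have := powR_lower_bound (divr_ge0 b0 (ltW a0)) ba1 r0.
rewrite -(ler_pM2l (powR_gt0 r a0)) mulrBr mulr1.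
have ab : a * (b / a) = b by rewrite mulrCA divff ?gt_eqF// mulr1.
rewrite -[a `^ r * (b / a) `^ r]powRM ?divr_ge0 ?(ltW a0)// ab.
move/le_trans; apply.
rewrite [a `^ (r - 1)]powRB ?(gt_eqF a0) ?implybT// (powRr1 (ltW a0)).
by rewrite le_eqVlt; apply/orP; left; apply/eqP; field; rewrite gt_eqF.
Qed.

(** The symmetric form, used on the two endpoints of an edge without knowing
    which value is the larger. *)
Lemma powR_grad_le a b r : 0 <= a -> 0 <= b -> 1 <= r ->
  `|a `^ r - b `^ r| <=
    (1 + r) * (a `^ (r - 1) * `|a - b| + b `^ (r - 1) * `|a - b|).
Proof.
move=> + + r1; wlog ba : a b / b <= a => [H a0 b0|a0 b0].
  have [ba|/ltW ba] := leP b a; first exact: H.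
  by rewrite distrC (distrC a) [X in _ * X]addrC; exact: H.
have r0 : 0 <= r by lra.
rewrite ger0_norm; last first.
  by rewrite subr_ge0 ge0_ler_powR// nnegrE.
rewrite ger0_norm ?subr_ge0//.
have Q : 0 <= (1 + r) * (b `^ (r - 1) * (a - b)).
  by rewrite !mulr_ge0 ?powR_ge0 ?subr_ge0// addr_ge0.
move: a0; rewrite le_eqVlt => /predU1P[a0|a0].
  have -> : b = a by apply/eqP; rewrite eq_le ba -a0 b0.
  by rewrite !subrr !mulr0 addr0 mulr0.
by rewrite mulrDr; apply: (le_trans (powR_sub_le b0 ba a0 r0)); rewrite lerDl.
Qed.

Definition signed_powR r a := Num.sg a * `|a| `^ r.

Lemma norm_signed_powR r a : 0 < r -> `|signed_powR r a| = `|a| `^ r.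
Proof.
move=> r0; rewrite /signed_powR normrM normr_sg ger0_norm ?powR_ge0//.
have [->|_] := eqVneq a 0; last by rewrite mul1r.
by rewrite mul0r normr0 powR0// gt_eqF.
Qed.

(** Two applications of [powR_sub_le]: once to a and b with exponent s/2, once
    to a^(s-1) and b^(s-1) with exponent (s/2)/(s-1).  The powers of a that
    appear have exponents s/2 - 1 and 1 - s/2, so they cancel in the product. *)
Lemma stroock_varopoulos_ge0 a b s : 1 < s -> 0 <= a -> 0 <= b ->
  (a `^ (s / 2) - b `^ (s / 2)) ^+ 2 <=
    (1 + s / 2) * (1 + (s / 2) / (s - 1)) *
    ((a - b) * (a `^ (s - 1) - b `^ (s - 1))).
Proof.
move=> s1; wlog ba : a b / b <= a => [H a0 b0|a0 b0].
  have [ba|/ltW ba] := leP b a; first exact: H.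
  have := H b a ba b0 a0.
  by rewrite -[leLHS]sqrrN opprB -[(b - a) * _]mulrNN !opprB.
move: (a0); rewrite le_eqVlt => /predU1P[a00|ap].
  have -> : b = a by apply/eqP; rewrite eq_le ba -a00 b0.
  by rewrite !subrr expr0n/= mul0r mulr0.
have sh : 0 <= s / 2 by lra.
have s10 : 0 < s - 1 by lra.
have L1 := powR_sub_le b0 ba ap sh.
have ab1 : b `^ (s - 1) <= a `^ (s - 1) by rewrite ge0_ler_powR ?nnegrE// ltW.
have shh : 0 <= s / 2 / (s - 1) by rewrite divr_ge0// ltW.
have := powR_sub_le (powR_ge0 b _) ab1 (powR_gt0 _ ap) shh.
(* The second exponent (s/2)/(s-1) is chosen so that it restores the power s/2. *)
have e1 : (s - 1) * (s / 2 / (s - 1)) = s / 2 by field; rewrite gt_eqF.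
have e2 : (s - 1) * (s / 2 / (s - 1) - 1) = s / 2 - (s - 1).
  by field; rewrite gt_eqF.
rewrite -!powRrM e1 e2 => L2.
have d0 : 0 <= a `^ (s / 2) - b `^ (s / 2).
  by rewrite subr_ge0 ge0_ler_powR ?nnegrE.
rewrite expr2; apply: (le_trans (ler_pM d0 d0 L1 L2)).
rewrite le_eqVlt; apply/orP; left; apply/eqP.
rewrite [LHS]mulrACA; congr (_ * _).
rewrite mulrACA -powRD ?(gt_eqF ap) ?implybT//.
by rewrite (_ : s / 2 - 1 + _ = 0) ?powRr0 ?mul1r//; field.
Qed.

(** The discrete substitute for the chain rule identity between
    |grad |u|^(s/2)|^2 and grad u . grad (sgn(u)|u|^(s-1)).  Passing from a, b
    to |a|, |b| decreases the right side: the diagonal terms are unchanged and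
    the mixed ones are estimated by their absolute values. *)
Lemma stroock_varopoulos a b s : 1 < s ->
  (`|a| `^ (s / 2) - `|b| `^ (s / 2)) ^+ 2 <=
    (1 + s / 2) * (1 + (s / 2) / (s - 1)) *
    ((a - b) * (signed_powR (s - 1) a - signed_powR (s - 1) b)).
Proof.
move=> s1; have s10 : 0 < s - 1 by lra.
apply: (le_trans (stroock_varopoulos_ge0 s1 (normr_ge0 a) (normr_ge0 b))).
apply: ler_wpM2l.
  have ? : 0 <= s / 2 / (s - 1) by rewrite divr_ge0; lra.
  by rewrite mulr_ge0; lra.
have H x : x * signed_powR (s - 1) x = `|x| * `|x| `^ (s - 1).
  by rewrite /signed_powR mulrA [x * _]mulrC -normrEsg.
have K x y : x * signed_powR (s - 1) y <= `|x| * `|y| `^ (s - 1).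
  by rewrite (le_trans (ler_norm _))// normrM norm_signed_powR.
have := K a b; have := K b a; have := H a; have := H b.
rewrite !mulrBl !mulrBr; lra.
Qed.

End PowerInequalities.

Section Hoelder.
Context {R : realType} {I : eqType}.
Implicit Types (r : seq I) (p : R).

(** Hoelder's inequality with the first function written as a power: p = 1 then
    needs no separate statement, since both powers of exponent 0 equal 1. *)
Lemma hoelder_sum r (a b : I -> R) p : 1 <= p ->
  (forall i, 0 <= a i) -> (forall i, 0 <= b i) ->
  \sum_(i <- r) a i `^ (1 - p^-1) * b i <=
    (\sum_(i <- r) a i) `^ (1 - p^-1) * (\sum_(i <- r) b i `^ p) `^ p^-1.
Proof.
rewrite le_eqVlt => /predU1P[<-|p1] a0 b0.
  rewrite invr1 subrr powRr0 mul1r powRr1; last first.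
    by apply: sumr_ge0 => i _; exact: powR_ge0.
  by apply: ler_sum => i _; rewrite powRr0 mul1r powRr1.
have p0 : 0 < p by lra.
have t0 : 0 < 1 - p^-1 by rewrite subr_gt0 invf_lt1.
set A := \sum_(i <- r) a i; set B := \sum_(i <- r) b i `^ p.
have [AE|A0] := eqVneq A 0.
  rewrite big_seq big1 ?mulr_ge0 ?powR_ge0// => i ir.
  have := AE => /eqP; rewrite psumr_eq0// => /allP/(_ _ ir)/= /eqP ->.
  by rewrite powR0 ?mul0r// gt_eqF.
have [BE|B0] := eqVneq B 0.
  rewrite big_seq big1 ?mulr_ge0 ?powR_ge0// => i ir.
  have := BE => /eqP; rewrite psumr_eq0//; last by move=> *; exact: powR_ge0.
  by move=> /allP/(_ _ ir)/= /eqP/powR_eq0_eq0 ->; rewrite mulr0.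
have Ap : 0 < A by rewrite lt_neqAle eq_sym A0 sumr_ge0.
have Bp : 0 < B by rewrite lt_neqAle eq_sym B0 sumr_ge0// => *; exact: powR_ge0.
have key i : a i `^ (1 - p^-1) * b i <= A `^ (1 - p^-1) * B `^ p^-1 *
    (a i / A * (1 - p^-1) + b i `^ p / B * p^-1).
  (* Young's inequality for the two functions normalised by their norms. *)
  have x0 : 0 <= (a i / A) `^ (1 - p^-1) by exact: powR_ge0.
  have y0 : 0 <= b i / B `^ p^-1 by rewrite divr_ge0// powR_ge0.
  have q0 : 0 < (1 - p^-1)^-1 by rewrite invr_gt0.
  have := conjugate_powR x0 y0 q0 p0; rewrite invrK subrK => /(_ erefl).
  rewrite -powRrM divff ?(gt_eqF t0)// powRr1 ?divr_ge0// ?(ltW Ap)//.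
  have divP (x y c : R) : 0 <= x -> 0 < y -> (x / y) `^ c = x `^ c / y `^ c.
    move=> x_ge0 y_gt0; have yV : 0 <= y^-1 by rewrite invr_ge0 ltW.
    by rewrite (powRM c x_ge0 yV) -(powR_inv1 (ltW y_gt0)) -powRrM mulN1r powRN.
  rewrite (divP _ _ _ (b0 i) (powR_gt0 _ Bp)) (divP _ _ _ (a0 i) Ap).
  rewrite -(powRrM B) mulVf ?(gt_eqF p0)// (powRr1 (ltW Bp)).
  have AB : 0 < A `^ (1 - p^-1) * B `^ p^-1 by rewrite mulr_gt0 ?powR_gt0.
  rewrite -(ler_pM2l AB); apply: le_trans.
  rewrite le_eqVlt; apply/orP; left; apply/eqP.
  by field; rewrite !gt_eqF ?powR_gt0.
apply: (le_trans (ler_sum _ (fun i _ => key i))).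
by rewrite -mulr_sumr big_split/= -!mulr_suml -/A -/B !divff// !mul1r subrK mulr1.
Qed.

End Hoelder.

(** * Sums of finitely supported functions on a group *)

Section FiniteSums.
Context {G : groupType} {R : realType}.
Implicit Types (f g h : G -> R) (F : {fset G}) (s : G).

(** A sum with infinite support is 0 by convention, which is why additivity and
    monotonicity below ask for finite support. *)
Definition tsum f : R := \sum_(x \in [set: G]) f x.

Lemma tsumE F f : (forall x, x \notin F -> f x = 0) ->
  tsum f = \sum_(x <- F) f x.
Proof. by move=> Ff; rewrite /tsum (fsbigTE F). Qed.

Lemma supp_fset f : finitely_supported f ->
  exists F, forall x, (x \in F) = (f x != 0).
Proof.
move=> ff; exists (fset_set [set x | f x != 0]) => x.
by rewrite in_fset_set// mem_setE.
Qed.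

Lemma fsetfs F f : (forall x, x \notin F -> f x = 0) -> finitely_supported f.
Proof.
move=> Ff; apply: (sub_finite_set _ (finite_fset F)) => x /=.
by apply: contra_neqT => /Ff.
Qed.

Lemma fs_sub f g : finitely_supported g ->
  (forall x, g x = 0 -> f x = 0) -> finitely_supported f.
Proof.
move=> + gf; apply: sub_finite_set => x /=.
by apply: contra_neq => /gf.
Qed.

Lemma fs_sub2 f g h : finitely_supported g -> finitely_supported h ->
  (forall x, g x = 0 -> h x = 0 -> f x = 0) -> finitely_supported f.
Proof.
move=> fg fh gf.
apply: (@sub_finite_set _ _ ([set x | g x != 0] `|` [set x | h x != 0])).
  move=> x /= f0; have [g0|] := eqVneq (g x) 0; last by left.
  by right; apply: contra_neq f0 => /(gf _ g0).
by rewrite finite_setU.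
Qed.

Lemma fs_shift f s : finitely_supported f ->
  finitely_supported (fun x => f (x * s)%g).
Proof.
move=> /supp_fset[F Ff]; apply: (@fsetfs [fset (x * s^-1)%g | x in F]%fset) => x.
apply: contraNeq; rewrite -Ff => xF; apply/imfsetP.
by exists (x * s)%g; rewrite // mulgK.
Qed.

Lemma fs_lshift f s : finitely_supported f ->
  finitely_supported (fun x => f (s * x)%g).
Proof.
move=> /supp_fset[F Ff]; apply: (@fsetfs [fset (s^-1 * x)%g | x in F]%fset) => x.
apply: contraNeq; rewrite -Ff => xF; apply/imfsetP.
by exists (s * x)%g; rewrite // mulKg.
Qed.

Lemma tsum_shift f s : tsum (fun x => f (x * s)%g) = tsum f.
Proof.
rewrite /tsum; apply/esym; apply: (@reindex_fsbigT _ _ _ _ _ (fun x => x * s)%g).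
by exists (fun x => x * s^-1)%g => x; rewrite ?mulgK ?mulgVK.
Qed.

Lemma tsum_lshift f s : tsum (fun x => f (s * x)%g) = tsum f.
Proof.
rewrite /tsum; apply/esym; apply: (@reindex_fsbigT _ _ _ _ _ (fun x => s * x)%g).
by exists (fun x => s^-1 * x)%g => x; rewrite ?mulKg ?mulVKg.
Qed.

Lemma tsum_ge0 f : (forall x, 0 <= f x) -> 0 <= tsum f.
Proof. by move=> f0; apply: fsumr_ge0. Qed.

Lemma tsumZ c f : tsum (fun x => c * f x) = c * tsum f.
Proof. by rewrite /tsum mulr_fsumr. Qed.

Lemma eq_tsum f g : f =1 g -> tsum f = tsum g.
Proof. by move=> /funext->. Qed.

Lemma tsum0 f : (forall x, f x = 0) -> tsum f = 0.
Proof. by move=> f0; apply: fsbig1. Qed.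

Lemma tsum_sum (I : Type) (r : seq I) (P : pred I) (f : I -> G -> R) :
  (forall i, finitely_supported (f i)) ->
  tsum (fun x => \sum_(i <- r | P i) f i x) = \sum_(i <- r | P i) tsum (f i).
Proof.
move=> ff.
have [F HF] : exists F, forall i, P i -> List.In i r ->
    forall x, x \notin F -> f i x = 0.
  elim: r => [|i r [F HF]]; first by exists fset0.
  have [F' F'f] := supp_fset (ff i); exists (F `|` F')%fset => j Pj [<-|jr] x.
    by rewrite inE negb_or F'f negbK => /andP[_ /eqP].
  by rewrite inE negb_or => /andP[xF _]; exact: (HF j).
have HF' i x : P i -> List.In i r -> x \notin F -> f i x = 0.
  by move=> /HF/[apply]; apply.
rewrite (@tsumE F); last first.
  move=> x xF; elim: r HF' {HF} => [|i r IH] HF; first by rewrite big_nil.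
  rewrite big_cons IH; last by move=> j y Pj jr; apply: HF => //; right.
  by case: ifPn => // Pi; rewrite (HF i)// ?addr0//; left.
rewrite exchange_big/=.
elim: r HF' {HF} => [|i r IH] HF; first by rewrite !big_nil.
rewrite !big_cons IH; last by move=> j y Pj jr; apply: HF => //; right.
case: ifPn => // Pi; rewrite (@tsumE F)// => x xF.
by apply: HF => //; left.
Qed.

Lemma tsumD f g : finitely_supported f -> finitely_supported g ->
  tsum (fun x => f x + g x) = tsum f + tsum g.
Proof.
move=> ff fg.
have := @tsum_sum bool [:: true; false] xpredT (fun b => if b then f else g).
rewrite !big_cons big_nil addr0 => <-; last by case.
by apply: eq_tsum => x; rewrite !big_cons big_nil addr0.
Qed.

Lemma tsumB f g : finitely_supported f -> finitely_supported g ->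
  tsum (fun x => f x - g x) = tsum f - tsum g.
Proof.
move=> ff fg; rewrite tsumD//; last by apply: (fs_sub fg) => x ->; rewrite oppr0.
by congr (_ + _); rewrite -mulN1r -tsumZ; apply: eq_tsum => x; rewrite mulN1r.
Qed.

Lemma le_tsum f g : finitely_supported f -> finitely_supported g ->
  (forall x, f x <= g x) -> tsum f <= tsum g.
Proof.
move=> ff fg fg_le; rewrite -subr_ge0 -tsumB//.
by apply: tsum_ge0 => x; rewrite subr_ge0.
Qed.

Lemma sum_le_tsum F f : finitely_supported f -> (forall x, 0 <= f x) ->
  \sum_(x <- F) f x <= tsum f.
Proof.
move=> ff f0.
rewrite -[leLHS](_ : tsum (fun x => (x \in F)%:R * f x) = _).
  apply: le_tsum => //; first by apply: (fs_sub ff) => x ->; rewrite mulr0.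
  by move=> x; case: (x \in F); rewrite (mul1r, mul0r).
rewrite (@tsumE F) => [|x /negbTE ->]; last by rewrite mul0r.
by apply: eq_big_seq => x ->; rewrite mul1r.
Qed.

Lemma hoelder_tsum p f g : 1 <= p ->
  finitely_supported f -> finitely_supported g ->
  (forall x, 0 <= f x) -> (forall x, 0 <= g x) ->
  tsum (fun x => f x `^ (1 - p^-1) * g x) <=
    tsum f `^ (1 - p^-1) * tsum (fun x => g x `^ p) `^ p^-1.
Proof.
move=> p1 /supp_fset[F Ff] /supp_fset[F' F'g] f0 g0.
have H x : x \notin (F `|` F')%fset -> f x = 0 /\ g x = 0.
  by rewrite inE negb_or Ff F'g !negbK => /andP[/eqP ? /eqP].
rewrite !(@tsumE (F `|` F')%fset); first exact: hoelder_sum.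
- by move=> x /H[_ ->]; rewrite powR0// gt_eqF// (lt_le_trans _ p1).
- by move=> x /H[].
- by move=> x /H[_ ->]; rewrite mulr0.
Qed.

Lemma fs_powR p f : 0 < p -> finitely_supported f ->
  finitely_supported (fun x => `|f x| `^ p).
Proof.
by move=> p0 /fs_sub; apply => x ->; rewrite normr0 powR0// gt_eqF.
Qed.

Definition indicator F (x : G) : R := (x \in F)%:R.

Lemma fs_indicator F : finitely_supported (indicator F).
Proof. by apply: (@fsetfs F) => x /negbTE xF; rewrite /indicator xF. Qed.

Lemma tsum_indicator F f : tsum (fun x => indicator F x * f x) = \sum_(x <- F) f x.
Proof.
rewrite (@tsumE F) => [|x /negbTE xF]; last by rewrite /indicator xF mul0r.
by apply: eq_big_seq => x xF; rewrite /indicator xF mul1r.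
Qed.

Lemma tsum_card F : tsum (indicator F) = #|` F|%:R.
Proof.
rewrite -[LHS](_ : tsum (fun x => indicator F x * 1) = _); last first.
  by apply: eq_tsum => x; rewrite mulr1.
by rewrite tsum_indicator big_const_seq count_predT iter_addr_0.
Qed.

End FiniteSums.

(** * Isoperimetry from volume growth *)

Section Isoperimetry.
Context {G : groupType} {R : realType} {m : nat} (S : m.-tuple G).
Implicit Types (f h : G -> R) (F B : {fset G}).

Lemma fs_partial_diff i f : finitely_supported f ->
  finitely_supported (partial_diff S i f).
Proof.
move=> ff; apply: (fs_sub2 (fs_shift (tnth S i) ff) ff) => x.
by rewrite /partial_diff => -> ->; rewrite subrr.
Qed.

(** For an indicator this counts the oriented boundary edges: it is the
    perimeter. *)
Definition gradient_l1 f : R :=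
  \sum_(i < m) tsum (fun x => `|partial_diff S i f x|).

Lemma fs_norm f : finitely_supported f -> finitely_supported (fun x => `|f x|).
Proof. by move=> /fs_sub; apply => x ->; rewrite normr0. Qed.

Lemma gradient_l1_ge0 f : 0 <= gradient_l1 f.
Proof. by apply: sumr_ge0 => i _; apply: tsum_ge0. Qed.

(** Telescoping along the word; every step is a translate of a single generator
    step. *)
Lemma word_translation_le f (w : seq G) :
  finitely_supported f -> {subset w <= S} ->
  tsum (fun x => `|f (x * \prod_(s <- w) s)%g - f x|) <=
    (size w)%:R * gradient_l1 f.
Proof.
move=> ff; elim: w => [|s w IH] wS.
  by rewrite mul0r tsum0// => x; rewrite big_nil mulg1 subrr normr0.
set g := (\prod_(s <- w) s)%g in IH.
have fd t : finitely_supported (fun x => `|f (x * t)%g - f x|).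
  by apply: (fs_sub2 (fs_shift t ff) ff) => x -> ->; rewrite subrr normr0.
have fdg := fs_shift s (fd g).
apply: (@le_trans _ _ (tsum (fun x =>
    `|f (x * s * g)%g - f (x * s)%g| + `|f (x * s)%g - f x|))).
  apply: le_tsum.
  - exact: fd.
  - by apply: (fs_sub2 fdg (fd s)) => x -> ->; rewrite addr0.
  - by move=> x; rewrite big_cons mulgA -(subrKA (f (x * s)%g)) ler_normD.
rewrite tsumD// (tsum_shift (fun x => `|f (x * g)%g - f x|)) -natr1 mulrDl mul1r.
apply: lerD; first by apply: IH => t tw; apply: wS; rewrite inE tw orbT.
have /tnthP[i ->] : s \in S by apply: wS; rewrite mem_head.
rewrite /gradient_l1 (bigD1 i)//= lerDl.
by apply: sumr_ge0 => j _; apply: tsum_ge0.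
Qed.

(** If a word ball were infinite its cardinal would be read as 0 and the finite
    set taken here would be empty; the lower bound on the growth excludes it
    without a separate proof that balls are finite. *)
Lemma ball_lower_bound N : polynomial_growth S R N -> exists2 c : R, 0 < c &
  forall n, (1 <= n)%N -> exists2 B, c * n%:R ^+ N <= #|` B|%:R &
    forall g, g \in B -> exists2 w : seq G, {subset w <= S} &
      (size w <= n)%N /\ g = (\prod_(s <- w) s)%g.
Proof.
move=> [c [C [c0 _ H]]]; exists c => // n n1.
exists (fset_set (word_ball S n)).
  by have /andP[] := H n n1.
move=> g; have [fin|nfin] := pselect (finite_set (word_ball S n)); last first.
  by rewrite /fset_set; case: pselect.
rewrite in_fset_set// inE => -[k kn [[w [wS ->]] _]].
by exists w => //; rewrite size_tuple.
Qed.

(** Let f be the indicator of F.  Sum over g in B the l^1 distance between f and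
    its translate by g.  Each term is at most n times the perimeter.  From
    below it is at least the number of x in F with x g outside F; for fixed x
    at most |F| elements g of B have x g in F, so that the total is at least
    |B||F| - |F|^2 >= |B||F|/2. *)
Lemma card_le_radius_perimeter F B n : (forall g, g \in B -> exists2 w : seq G,
    {subset w <= S} & (size w <= n)%N /\ g = (\prod_(s <- w) s)%g) ->
  (2 * #|` F| <= #|` B|)%N ->
  #|` F|%:R <= 2 * n%:R * gradient_l1 (indicator F).
Proof.
move=> Bw FB; set f := indicator F; set V := gradient_l1 f.
have V0 : 0 <= V := gradient_l1_ge0 f.
have ff : finitely_supported f := fs_indicator F.
have f0 x : 0 <= f x by rewrite /f /indicator.
have [F0|Fgt0] := posnP #|` F|; first by rewrite F0 !mulr_ge0.
have fff g : finitely_supported (fun x => f x * f (x * g)%g).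
  by apply: (fs_sub ff) => x ->; rewrite mul0r.
have up : \sum_(g <- B) tsum (fun x => `|f (x * g)%g - f x|) <=
    #|` B|%:R * (n%:R * V).
  rewrite mulr_natl -iter_addr_0 -(count_predT B) -big_const_seq.
  rewrite !big_seq; apply: ler_sum => g /Bw[w wS [wn ->]].
  rewrite (le_trans (word_translation_le ff wS))//.
  by rewrite ler_wpM2r// ler_nat.
have low : #|` B|%:R * #|` F|%:R - #|` F|%:R * #|` F|%:R <=
    \sum_(g <- B) tsum (fun x => `|f (x * g)%g - f x|).
  apply: (@le_trans _ _
      (\sum_(g <- B) (tsum f - tsum (fun x => f x * f (x * g)%g)))).
    rewrite sumrB; apply: lerB.
      by rewrite big_const_seq count_predT iter_addr_0 tsum_card mulr_natl.
    rewrite -tsum_sum//.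
    rewrite -[X in _ <= X * _]tsum_card [leRHS]mulrC -tsumZ; apply: le_tsum.
    - by apply: (fs_sub ff) => x fx; apply: big1 => g _; rewrite fx mul0r.
    - by apply: (fs_sub ff) => x fx; rewrite -/f fx mulr0.
    - move=> x; rewrite -mulr_sumr mulrC ler_wpM2r//.
      rewrite -(@tsum_card G R) -(tsum_lshift _ x).
      exact: sum_le_tsum (fs_lshift x ff) _.
  apply: ler_sum => g _; rewrite -tsumB//; apply: le_tsum.
  - by apply: (fs_sub ff) => x ->; rewrite mul0r subrr.
  - by apply: (fs_sub2 (fs_shift g ff) ff) => x -> ->; rewrite subrr normr0.
  move=> x; rewrite /f /indicator; case: (x \in F); case: (_ \in F);
  rewrite /= ?(mulr1n, mulr0n)
    ?(mul1r, mul0r, subrr, normr0, subr0, sub0r, normrN, normr1)//.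
have := le_trans low up.
have B0 : 0 < #|` B|%:R :> R by rewrite ltr0n (leq_trans _ FB)// muln_gt0.
have FBr : 2 * #|` F|%:R <= #|` B|%:R :> R by rewrite -natrM ler_nat.
move=> H; rewrite -(ler_pM2l B0).
have : #|` F|%:R * (2 * #|` F|%:R) <= #|` F|%:R * #|` B|%:R :> R.
  by apply: ler_wpM2l.
lra.
Qed.

Lemma isoperimetric_inequality N : (1 < N)%N -> polynomial_growth S R N ->
  exists2 K : R, 0 < K & forall F,
    #|` F|%:R `^ (1 - N%:R^-1) <= K * gradient_l1 (indicator F).
Proof.
move=> N0 /ball_lower_bound[c c0 H].
have Nr0 : 0 < N%:R :> R by rewrite ltr0n ltnW.
(* The growth gives at least 2|F| elements to a ball of radius k |F|^(1/N);
   rounding the radius up costs at most 1, and 1 <= |F|^(1/N). *)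
pose k : R := (2 / c) `^ N%:R^-1.
have k0 : 0 < k by rewrite powR_gt0// divr_gt0.
exists (2 * (k + 1)); first by rewrite mulr_gt0// addr_gt0.
move=> F; have [F0|F0] := posnP #|` F|.
  rewrite F0 powR0; last by rewrite subr_eq0 eq_sym invr_eq1 pnatr_eq1 gtn_eqF.
  by rewrite !mulr_ge0 ?gradient_l1_ge0// addr_ge0// ltW.
pose t : R := #|` F|%:R `^ N%:R^-1.
have t1 : 1 <= t.
  by rewrite -(@powRr0 _ #|` F|%:R) ler_powR// ?ler1n// invr_ge0 ltW.
have kt0 : 0 <= k * t by rewrite mulr_ge0 ?ltW// (lt_le_trans ltr01).
pose n := (Num.truncn (k * t)).+1.
have [B cB Bw] := H n isT.
have ktn : k * t <= n%:R by rewrite ltW// truncnS_gt.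
have nkt : n%:R <= (k + 1) * t.
  by rewrite -natr1 mulrDl mul1r lerD// truncn_le.
have FB : (2 * #|` F| <= #|` B|)%N.
  rewrite -(ler_nat R) (le_trans _ cB)//.
  rewrite -powR_mulrn//.
  apply: (@le_trans _ _ (c * (k * t) `^ N%:R)).
    rewrite powRM ?powR_ge0// /k /t -!powRrM mulVf ?gt_eqF// !powRr1//; last first.
      by rewrite divr_ge0// ltW.
    by rewrite natrM le_eqVlt; apply/orP; left; apply/eqP; field; rewrite gt_eqF.
  by apply: ler_wpM2l; [exact: ltW|rewrite ge0_ler_powR// nnegrE].
have V0 := gradient_l1_ge0 (indicator F).
have tp : 0 < t by lra.
have Fr : 0 < #|` F|%:R :> R by rewrite ltr0n.
rewrite powRB ?(gt_eqF Fr) ?implybT// powRr1 -/t ?(ltW Fr)// ler_pdivrMr//.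
apply: (le_trans (card_le_radius_perimeter Bw FB)).
have : n%:R * gradient_l1 (indicator F) <=
    (k + 1) * t * gradient_l1 (indicator F) by exact: ler_wpM2r.
lra.
Qed.

Lemma fset_argmin F f : F != fset0 ->
  exists2 x, x \in F & forall y, y \in F -> f x <= f y.
Proof.
move=> /fset0Pn[x0 x0F].
case: (@arg_minP _ _ F [` x0F]%fset xpredT (fun y => f (val y)) isT) => x _ xmin.
by exists (val x) => [|y yF]; [exact: valP|exact: (xmin [` yF]%fset)].
Qed.

(** Coarea formula, by induction on the support: subtracting the least positive
    value t of f on its support F removes t times the indicator of F, and the
    l^1 norm of the gradient splits exactly because the two pieces vary in
    the same direction along every edge.  Testing against h replaces
    Minkowski's inequality for the level sets. *)
Lemma layer_cake_bound K h :
  (forall F, \sum_(x <- F) h x <= K * gradient_l1 (indicator F)) ->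
  forall f, finitely_supported f -> (forall x, 0 <= f x) ->
    tsum (fun x => f x * h x) <= K * gradient_l1 f.
Proof.
move=> hK f /supp_fset[F]; move En : #|` F| => n.
elim/ltn_ind: n f F En => n IH f F Fn Ff f0.
have [F0|FN0] := eqVneq F fset0.
  have fE x : f x = 0 by apply/eqP; rewrite -[_ == _]negbK -Ff F0.
  rewrite tsum0 => [|x]; last by rewrite fE mul0r.
  rewrite /gradient_l1 big1 ?mulr0// => i _; rewrite tsum0// => x.
  by rewrite /partial_diff !fE subrr normr0.
have [x0 x0F x0min] := fset_argmin f FN0.
set t := f x0 in x0min.
have t0 : 0 < t by rewrite lt_neqAle eq_sym -Ff x0F f0.
pose f' x := f x - t * indicator F x.
pose F' := [fset x in F | f x != t]%fset.
have F'f x : (x \in F') = (f' x != 0).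
  rewrite !inE /f' /indicator; have [xF|xF] /= := boolP (x \in F).
    by rewrite mulr1 subr_eq0.
  by rewrite mulr0 subr0 -Ff (negbTE xF).
have f'0 x : 0 <= f' x.
  rewrite /f' /indicator; have [xF|xF] /= := boolP (x \in F).
    by rewrite mulr1 subr_ge0 x0min.
  by rewrite mulr0 subr0.
have F'n : (#|` F'| < n)%N.
  rewrite -Fn; apply: fproper_ltn_card; rewrite fproperE.
  apply/andP; split; first by apply/fsubsetP => x; rewrite !inE => /andP[].
  by apply/negP => /fsubsetP/(_ _ x0F); rewrite !inE x0F eqxx.
have := IH _ F'n f' F' erefl F'f f'0.
have ff' : finitely_supported f'.
  by apply: (@fsetfs _ _ F') => x; rewrite F'f negbK => /eqP.
have fi := fs_indicator (R := R) F.
have -> : tsum (fun x => f x * h x) =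
    t * \sum_(x <- F) h x + tsum (fun x => f' x * h x).
  rewrite -tsum_indicator -tsumZ -tsumD.
  - by apply: eq_tsum => x; rewrite /f'; ring.
  - by apply: (fs_sub fi) => x ->; rewrite mul0r mulr0.
  - by apply: (fs_sub ff') => x ->; rewrite mul0r.
have -> : gradient_l1 f =
    t * gradient_l1 (indicator F) + gradient_l1 f'.
  rewrite /gradient_l1 mulr_sumr -big_split/=; apply: eq_bigr => i _.
  rewrite -tsumZ -tsumD.
  (* On an edge with one endpoint outside F both terms have the sign of the
       endpoint inside F, where f >= t. *)
  - apply: eq_tsum => x; rewrite /partial_diff /f' /indicator.
    set y := (x * _)%g.
    have off z : z \notin F -> f z = 0 by rewrite Ff negbK => /eqP.
    have [xF|xF] := boolP (x \in F); have [yF|yF] /= := boolP (y \in F);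
      rewrite ?(off _ xF) ?(off _ yF) ?(mulr1n, mulr0n).
    + by rewrite subrr normr0 mulr0 add0r; congr `|_|; ring.
    + have := x0min _ xF; rewrite !(mulr1, mulr0, sub0r, subr0, oppr0) => tx.
      by rewrite !normrN normr1 !ger0_norm ?subr_ge0 ?f0//; ring.
    + have := x0min _ yF; rewrite !(mulr1, mulr0, sub0r, subr0, oppr0) => ty.
      by rewrite normr1 !ger0_norm ?subr_ge0 ?f0//; ring.
    + by rewrite !(subrr, mulr0, normr0, addr0, subr0).
  - by apply: (fs_sub (fs_norm (fs_partial_diff i fi))) => x ->; rewrite mulr0.
  - exact: fs_norm (fs_partial_diff i ff').
have : t * \sum_(x <- F) h x <= t * (K * gradient_l1 (indicator F)).
  by rewrite ler_pM2l.
lra.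
Qed.

End Isoperimetry.

(** * First-order Sobolev inequalities *)

Section Sobolev.
Context {G : groupType} {R : realType} {m : nat} (S : m.-tuple G).
Implicit Types (f g h u v : G -> R) (p q : R) (N : nat).

Definition power_sum p f : R := tsum (fun x => `|f x| `^ p).

Definition energy p f : R := \sum_(i < m) power_sum p (partial_diff S i f).

Lemma power_sum_ge0 p f : 0 <= power_sum p f.
Proof. by apply: tsum_ge0 => x; exact: powR_ge0. Qed.

Lemma energy_ge0 p f : 0 <= energy p f.
Proof. by apply: sumr_ge0 => i _; exact: power_sum_ge0. Qed.

Lemma power_sum_partial_le p f i : power_sum p (partial_diff S i f) <= energy p f.
Proof.
rewrite /energy (bigD1 i)//= lerDl.
by apply: sumr_ge0 => j _; exact: power_sum_ge0.
Qed.

(** The chain rule for |v|^(1+e) with e = q(1-1/p): along an edge the difference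
    is at most a constant times |v|^e |grad v|, and |v|^e is the power 1 - 1/p
    of |v|^q, ready for Hoelder. *)
Lemma gradient_l1_powR_le p q v : 1 <= p -> 0 < q ->
  finitely_supported v ->
  gradient_l1 S (fun x => `|v x| `^ (1 + q * (1 - p^-1))) <=
    m%:R * (2 * (2 + q * (1 - p^-1))) *
    (power_sum q v `^ (1 - p^-1) * energy p v `^ p^-1).
Proof.
move=> p1 q0 fv; set e := q * (1 - p^-1); set X := _ * energy _ _ `^ _.
have p0 : 0 < p by lra.
have e0 : 0 <= e by rewrite mulr_ge0 ?(ltW q0)// subr_ge0 invf_le1.
have fq := fs_powR q0 fv.
have fr : finitely_supported (fun x => `|v x| `^ (1 + e)).
  by apply: fs_powR => //; lra.
have half (i : 'I_m) z : finitely_supported z -> (power_sum q z = power_sum q v) ->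
    tsum (fun x => `|z x| `^ e * `|partial_diff S i v x|) <= X.
  move=> fz zv.
  have := hoelder_tsum p1 (fs_powR q0 fz) (fs_norm (fs_partial_diff S i fv))
    (fun x => powR_ge0 _ _) (fun x => normr_ge0 _).
  under eq_tsum do rewrite -powRrM -/e.
  move/le_trans; apply; rewrite -/(power_sum q z) zv ler_wpM2l ?powR_ge0//.
  rewrite ge0_ler_powR ?nnegrE ?invr_ge0 ?(ltW p0) ?energy_ge0 ?tsum_ge0//.
  exact: power_sum_partial_le.
rewrite /gradient_l1.
apply: (@le_trans _ _ (\sum_(i < m) 2 * (2 + e) * X)); last first.
  by rewrite sumr_const card_ord -[leRHS]mulrA -[leLHS]mulr_natl.
apply: ler_sum => i _.
have fdi := fs_norm (fs_partial_diff S i fv).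
pose vs x := v (x * tnth S i)%g.
have fvs : finitely_supported vs := fs_shift _ fv.
have f1 : finitely_supported (fun x => `|vs x| `^ e * `|partial_diff S i v x|).
  by apply: (fs_sub fdi) => x ->; rewrite mulr0.
have f2 : finitely_supported (fun x => `|v x| `^ e * `|partial_diff S i v x|).
  by apply: (fs_sub fdi) => x ->; rewrite mulr0.
have f12 : finitely_supported (fun x => `|vs x| `^ e * `|partial_diff S i v x| +
    `|v x| `^ e * `|partial_diff S i v x|).
  by apply: (fs_sub2 f1 f2) => x -> ->; rewrite addr0.
apply: (@le_trans _ _ (tsum (fun x => (2 + e) *
    (`|vs x| `^ e * `|partial_diff S i v x| +
     `|v x| `^ e * `|partial_diff S i v x|)))).
  apply: le_tsum.
  - exact: fs_norm (fs_partial_diff S i fr).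
  - by apply: (fs_sub f12) => x ->; rewrite mulr0.
  move=> x; have e1 : 1 <= 1 + e by lra.
  have := powR_grad_le (normr_ge0 (vs x)) (normr_ge0 (v x)) e1.
  rewrite (_ : 1 + (1 + e) = 2 + e); last by ring.
  rewrite (_ : 1 + e - 1 = e); last by ring.
  move/le_trans; apply; rewrite ler_pM2l; last by lra.
  by rewrite lerD// ler_wpM2l ?powR_ge0//; exact: ler_dist_dist.
rewrite tsumZ tsumD//.
have H1 : tsum (fun x => `|vs x| `^ e * `|partial_diff S i v x|) <= X.
  by apply: half => //; exact: (tsum_shift (fun x => `|v x| `^ q)).
have H2 := half i v fv erefl.
rewrite [2 * _]mulrC -mulrA ler_pM2l; last by lra.
lra.
Qed.

(** Let A be the sum of |v|^q.  The choice of exponents gives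
    A <= C A^(1/N) A^(1-1/p) |grad v|_p, and A^(1/N+1-1/p) is cancelled; what
    remains of A is A^(1/q). *)
Lemma sobolev N p : (1 < N)%N -> polynomial_growth S R N -> 1 <= p -> p < N%:R ->
  let q := N%:R * p / (N%:R - p) in
  exists2 K : R, 0 <= K & forall v, finitely_supported v ->
    power_sum q v `^ q^-1 <= K * energy p v `^ p^-1.
Proof.
move=> N1 gr p1 pN q.
have [K K0 isop] := isoperimetric_inequality N1 gr.
have p0 : 0 < p by lra.
have Np : 0 < N%:R - p by lra.
have N0 : 0 < N%:R :> R by lra.
have N1r : 1 <= N%:R :> R by lra.
have q0 : 0 < q by rewrite divr_gt0// mulr_gt0.
have e0 : 0 <= q * (1 - p^-1) by rewrite mulr_ge0 ?(ltW q0)// subr_ge0 invf_le1.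
exists (K * (m%:R * (2 * (2 + q * (1 - p^-1))))).
  by rewrite !mulr_ge0 ?(ltW K0)//; lra.
move=> v fv; set A := power_sum q v.
have A0 : 0 <= A := power_sum_ge0 q v.
have K'0 : 0 <= K * (m%:R * (2 * (2 + q * (1 - p^-1)))).
  by rewrite !mulr_ge0 ?(ltW K0)//; lra.
have [AE|An0] := eqVneq A 0.
  by rewrite AE powR0 ?invr_eq0 ?gt_eqF// mulr_ge0 ?powR_ge0.
have Ap : 0 < A by rewrite lt_neqAle eq_sym An0.
pose h x := `|v x| `^ (q / N%:R).
have qN0 : 0 < q / N%:R by rewrite divr_gt0.
have fh : finitely_supported h by exact: fs_powR.
have hF (F : {fset G}) : \sum_(x <- F) h x <=
    K * A `^ N%:R^-1 * gradient_l1 S (indicator F).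
  have fi := fs_indicator (R := R) F.
  have := hoelder_tsum N1r fi fh (fun x => ler0n _ _) (fun x => powR_ge0 _ _).
  under eq_tsum => x.
    rewrite (_ : _ `^ _ = indicator F x).
    over.
    rewrite /indicator; case: (x \in F); rewrite ?powR1//= powR0//.
    by rewrite gt_eqF// subr_gt0 invf_lt1// ltr1n.
  rewrite tsum_indicator => /le_trans; apply.
  have -> : tsum (fun x => h x `^ N%:R) = A.
    by apply: eq_tsum => x; rewrite /h -powRrM divfK// gt_eqF.
  rewrite tsum_card [leRHS]mulrAC ler_wpM2r ?powR_ge0//.
have := layer_cake_bound hF (fs_powR (_ : 0 < 1 + q * (1 - p^-1)) fv)
  (fun x => powR_ge0 _ _).
(* The first two terms add up to q(1 - 1/N). *)
have qE : 1 + q * (1 - p^-1) + q / N%:R = q.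
  by rewrite /q; field; rewrite !gt_eqF.
under eq_tsum do rewrite /h -powRD ?qE ?(gt_eqF q0)//.
rewrite -/(power_sum q v) -/A => /(_ ltac:(lra)) H.
have := le_trans H (ler_wpM2l _ (gradient_l1_powR_le p1 q0 fv)).
move=> /(_ ltac:(by rewrite mulr_ge0 ?powR_ge0 ?(ltW K0))).
(* 1 = 1/q + 1/N + (1 - 1/p) for q = Np/(N-p). *)
have AE : A = A `^ q^-1 * (A `^ N%:R^-1 * A `^ (1 - p^-1)).
  rewrite -!powRD ?(gt_eqF Ap) ?implybT// -[LHS]powRr1//.
  by congr (_ `^ _); rewrite /q; field; rewrite !gt_eqF.
have AA : 0 < A `^ N%:R^-1 * A `^ (1 - p^-1) by rewrite mulr_gt0 ?powR_gt0.
rewrite -/A [leLHS]AE => H'; rewrite -(ler_pM2r AA); apply: (le_trans H').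
by rewrite le_eqVlt; apply/orP; left; apply/eqP; ring.
Qed.

End Sobolev.

(** * Second-order inequalities for finitely supported functions *)

Section SecondOrder.
Context {G : groupType} {R : realType} {m : nat} (S : m.-tuple G).
Implicit Types (f g h u v : G -> R) (p q : R) (N : nat).

Lemma laplacianE u x : uniq S ->
  laplacian S u x = \sum_(i < m) partial_diff S i u x.
Proof.
move=> S_uniq; rewrite /laplacian.
rewrite (_ : [set y | cayley_adj S y x] = [set` [seq (x * s)%g | s <- S]]).
  rewrite -fsbig_seq; last by rewrite map_inj_uniq//; exact: mulgI.
  by rewrite big_map big_tuple.
apply/seteqP; split=> y /=; first by move=> [s sS ->]; exact: map_f.
by move=> /mapP[s sS ->]; exists s.
Qed.

Lemma fs_laplacian u : uniq S -> finitely_supported u ->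
  finitely_supported (laplacian S u).
Proof.
move=> S_uniq fu; have fi i := supp_fset (fs_partial_diff S i fu).
have /choice[F HF] := fi.
apply: (@fsetfs _ _ (\bigcup_(i <- enum 'I_m) F i)%fset) => x xF.
rewrite laplacianE//; apply: big1 => i _; apply/eqP; rewrite -[_ == _]negbK -HF.
apply: contra xF => xFi; apply/bigfcupP; exists i => //.
by rewrite mem_enum.
Qed.

(** Every unoriented edge is seen twice, from both of its endpoints, since S is
    symmetric: the substitution x -> x s^-1 exchanges s and s^-1. *)
Lemma summation_by_parts u g : uniq S -> symmetric_set S ->
  finitely_supported u -> finitely_supported g ->
  \sum_(i < m) tsum (fun x => partial_diff S i u x * partial_diff S i g x) =
  - 2 * tsum (fun x => laplacian S u x * g x).
Proof.
move=> S_uniq S_sym fu fg.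
pose D s := tsum (fun x => (u (x * s)%g - u x) * g x).
have fD s : finitely_supported (fun x => (u (x * s)%g - u x) * g x).
  by apply: (fs_sub fg) => x ->; rewrite mulr0.
have LE : tsum (fun x => laplacian S u x * g x) = \sum_(s <- S) D s.
  rewrite big_tuple -tsum_sum//.
  by apply: eq_tsum => x; rewrite laplacianE// mulr_suml.
have SV : \sum_(s <- S) D (s^-1)%g = \sum_(s <- S) D s.
  rewrite -(big_map (fun s : G => s^-1)%g xpredT D); apply: perm_big.
  have S'uniq : uniq [seq (s^-1)%g | s <- S].
    by rewrite map_inj_uniq//; exact: invg_inj.
  apply: uniq_perm => // y.
  apply/mapP/idP => [[s sS ->]|yS]; first exact: S_sym.
  by exists (y^-1)%g; [exact: S_sym|rewrite invgK].
rewrite LE mulNr mulr_natl mulr2n opprD -[in X in X - _]SV -!sumrN -big_split/=.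
rewrite big_tuple; apply: eq_bigr => i _; set s := tnth S i.
have -> : D (s^-1)%g = - tsum (fun x => (u (x * s)%g - u x) * g (x * s)%g).
  rewrite -mulN1r -tsumZ -[LHS](tsum_shift _ s).
  by apply: eq_tsum => x; rewrite mulgK; ring.
rewrite opprK -tsumB//; last first.
  by apply: (fs_sub (fs_shift s fg)) => x ->; rewrite mulr0.
by apply: eq_tsum => x; rewrite /partial_diff -/s; ring.
Qed.

(** Testing -Delta u against sgn(u)|u|^(s-1) gives, with A the sum of |u|^q,
    A^((N-2)/N) <= C A^(1-1/p) |Delta u|_p, and (N-2)/N - (1-1/p) = 1/q. *)
Lemma laplacian_bound N p : uniq S -> symmetric_set S ->
  polynomial_growth S R N -> 1 < p -> p < N%:R / 2 ->
  let q := sobolev_exp2 N p in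
  exists2 K : R, 0 <= K & forall u, finitely_supported u ->
    power_sum q u `^ q^-1 <= K * power_sum p (laplacian S u) `^ p^-1.
Proof.
move=> S_uniq S_sym gr p1 pN q.
have N2 : 2 < N%:R :> R by lra.
have N1 : (1 < N)%N by rewrite -(ltr_nat R); lra.
have [K K0 sob] := sobolev N1 gr (ler1n R 2) N2.
set q2 := _ / _ in sob.
pose s := p * (N%:R - 2) / (N%:R - 2 * p).
have d0 : 0 < N%:R - 2 * p by lra.
have q0 : 0 < q by rewrite divr_gt0// mulr_gt0; lra.
have s1 : 1 < s.
  by rewrite ltr_pdivlMr// mul1r; nra.
have q20 : 0 < q2 by rewrite divr_gt0; lra.
pose C : R := (1 + s / 2) * (1 + (s / 2) / (s - 1)).
have C0 : 0 <= C.
  have ? : 0 <= s / 2 / (s - 1) by rewrite divr_ge0; lra.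
  by rewrite /C mulr_ge0; lra.
have K'0 : 0 <= K ^+ 2 * (2 * C) by apply: mulr_ge0; [exact: exprn_ge0|lra].
exists (K ^+ 2 * (2 * C)) => // u fu.
set A := power_sum q u; set L := power_sum p (laplacian S u) `^ p^-1.
have A0 : 0 <= A := power_sum_ge0 q u.
have [AE|An0] := eqVneq A 0.
  by rewrite AE powR0 ?invr_eq0 ?gt_eqF// mulr_ge0 ?powR_ge0.
have Ap : 0 < A by rewrite lt_neqAle eq_sym An0.
pose w x := `|u x| `^ (s / 2).
have s20 : 0 < s / 2 by lra.
have fw : finitely_supported w by exact: fs_powR.
pose g x := signed_powR (s - 1) (u x).
have fg : finitely_supported g.
  by apply: (fs_sub fu) => x; rewrite /g /signed_powR => ->; rewrite sgr0 mul0r.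
have wA : power_sum q2 w = A.
  apply: eq_tsum => x; rewrite /w ger0_norm ?powR_ge0// -powRrM.
  by congr (_ `^ _); rewrite /s /q2 /q /sobolev_exp2; field; rewrite !gt_eqF//; lra.
have fdw i : finitely_supported (fun x => `|partial_diff S i w x| `^ 2).
  by apply: fs_powR => //; exact: fs_partial_diff.
have EC : energy S 2 w <= 2 * C * (A `^ (1 - p^-1) * L).
  have step1 : energy S 2 w <=
      C * (- 2 * tsum (fun x => laplacian S u x * g x)).
    rewrite -summation_by_parts// mulr_sumr; apply: ler_sum => i _.
    rewrite -tsumZ; apply: le_tsum => //.
      by apply: (fs_sub (fs_partial_diff S i fu)) => x ->; rewrite mul0r mulr0.
    move=> x; rewrite powR_mulrn// real_normK ?num_real//.
    exact: stroock_varopoulos.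
  have step2 : - tsum (fun x => laplacian S u x * g x) <= A `^ (1 - p^-1) * L.
    have flap := fs_laplacian S_uniq fu.
    apply: le_trans (hoelder_tsum (ltW p1) (fs_powR q0 fu) (fs_norm flap)
      (fun x => powR_ge0 _ _) (fun x => normr_ge0 _)).
    rewrite -mulN1r -tsumZ; apply: le_tsum.
    - by apply: (fs_sub flap) => x ->; rewrite mul0r mulr0.
    - by apply: (fs_sub flap) => x ->; rewrite normr0 mulr0.
    move=> x; rewrite mulN1r (le_trans (ler_norm _))// normrN normrM mulrC.
    rewrite norm_signed_powR; last by lra.
    rewrite -powRrM (_ : s - 1 = q * (1 - p^-1))//.
    by rewrite /s /q /sobolev_exp2; field; rewrite !gt_eqF//; lra.
  apply: (le_trans step1).
  have := ler_wpM2l C0 step2; lra.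
have := sob w fw; rewrite wA => H.
have H2 : (A `^ q2^-1) ^+ 2 <= (K * energy S 2 w `^ 2^-1) ^+ 2.
  by rewrite lerXn2r ?nnegrE// ?powR_ge0// mulr_ge0// powR_ge0.
move: H2; rewrite exprMn -[X in X <= _](powR_mulrn 2) ?powR_ge0//.
rewrite -[X in _ * X](powR_mulrn 2) ?powR_ge0// -!powRrM mulVf ?pnatr_eq0//.
rewrite powRr1 ?energy_ge0// => H2.
have K20 : 0 <= K ^+ 2 by exact: exprn_ge0.
have {}H2 := le_trans H2 (ler_wpM2l K20 EC).
have AA : 0 < A `^ (1 - p^-1) by rewrite powR_gt0.
rewrite -(ler_pM2l AA); apply: le_trans (le_trans H2 _).
  rewrite -powRD ?(gt_eqF Ap) ?implybT// le_eqVlt; apply/orP; left; apply/eqP.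
  by congr (_ `^ _); rewrite /q2 /q /sobolev_exp2; field; rewrite !gt_eqF//; lra.
by rewrite le_eqVlt; apply/orP; left; apply/eqP; ring.
Qed.

Definition hessian_energy p f : R :=
  \sum_(i < m) energy S p (partial_diff S i f).

(** Sobolev's inequality from exponent p to r = Np/(N-p), then from r to
    Nr/(N-r) = Np/(N-2p); p < N/2 is what makes r < N. *)
Lemma hessian_bound N p : polynomial_growth S R N -> 1 <= p -> p < N%:R / 2 ->
  let q := sobolev_exp2 N p in
  exists2 K : R, 0 <= K & forall u, finitely_supported u ->
    power_sum q u `^ q^-1 <= K * hessian_energy p u `^ p^-1.
Proof.
move=> gr p1 pN q.
have N1 : (1 < N)%N by rewrite -(ltr_nat R); lra.
have pN' : p < N%:R by lra.
have [K K0 sob] := sobolev N1 gr p1 pN'.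
set r := _ / _ in sob.
have d0 : 0 < N%:R - p by lra.
have r1 : 1 <= r by rewrite ler_pdivlMr//; nra.
have rN : r < N%:R by rewrite ltr_pdivrMr// ltr_pM2l; lra.
have [K' K'0 sob'] := sobolev N1 gr r1 rN.
set q' := _ / _ in sob'.
have qE : q' = q.
  rewrite /q' /q /r /sobolev_exp2; field.
  rewrite -mulrBr mulf_eq0 !negb_or !gt_eqF//=; lra.
rewrite {}qE in sob'.
have r0 : 0 < r by lra.
exists (K' * (m%:R `^ r^-1 * K)).
  by rewrite !mulr_ge0// powR_ge0.
move=> u fu; apply: (le_trans (sob' u fu)).
rewrite -!mulrA ler_wpM2l//.
set D := hessian_energy p u.
have D0 : 0 <= D by apply: sumr_ge0 => i _; exact: energy_ge0.
have H i : power_sum r (partial_diff S i u) <= (K * D `^ p^-1) `^ r.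
  have := sob _ (fs_partial_diff S i fu).
  have Di : energy S p (partial_diff S i u) <= D.
    rewrite /D /hessian_energy (bigD1 i)//= lerDl.
    by apply: sumr_ge0 => j _; exact: energy_ge0.
  have KD : K * energy S p (partial_diff S i u) `^ p^-1 <= K * D `^ p^-1.
    by rewrite ler_wpM2l// ge0_ler_powR ?nnegrE ?energy_ge0// invr_ge0; lra.
  move=> /le_trans/(_ KD) H.
  by rewrite -powR_inv_le ?power_sum_ge0// mulr_ge0// powR_ge0.
have HE : energy S r u <= m%:R * (K * D `^ p^-1) `^ r.
  apply: (le_trans (ler_sum _ (fun i _ => H i))).
  by rewrite sumr_const card_ord mulr_natl.
apply: (@le_trans _ _ ((m%:R * (K * D `^ p^-1) `^ r) `^ r^-1)).
  rewrite ge0_ler_powR ?nnegrE ?energy_ge0 ?invr_ge0 ?(ltW r0)//.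
  by rewrite mulr_ge0// powR_ge0.
rewrite powRM ?powR_ge0// -powRrM divff ?gt_eqF// powRr1//.
by rewrite mulr_ge0// powR_ge0.
Qed.

End SecondOrder.

(** * Extension to completions *)

Section Completion.
Context {G : groupType} {R : realType}.
Implicit Types (p q : R) (u v : G -> R) (F : {fset G}).

Lemma cvg_bigsum (I : Type) (r : seq I) (f : I -> nat -> R) (l : I -> R) :
  (forall i, f i n @[n --> \oo] --> l i) ->
  \sum_(i <- r) f i n @[n --> \oo] --> \sum_(i <- r) l i.
Proof.
move=> fl; elim: r => [|i r IH].
  by rewrite big_nil; under eq_fun do rewrite big_nil; exact: cvg_cst.
by rewrite big_cons; under eq_fun do rewrite big_cons; exact: cvgD.
Qed.

(** Away from 0 the power is differentiable; at 0, for exponents below 1, it is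
    not, and continuity is checked by hand. *)
Lemma cvg_powR_norm (f : nat -> R) l p : 0 < p -> f n @[n --> \oo] --> l ->
  `|f n| `^ p @[n --> \oo] --> `|l| `^ p.
Proof.
move=> p0 fl.
have [l0|l0] := eqVneq l 0.
  rewrite l0 normr0 powR0 ?gt_eqF//; apply/cvgr0Pnorm_lt => e e0.
  have ep : 0 < e `^ p^-1 by exact: powR_gt0.
  move: fl; rewrite l0 => /cvgr0Pnorm_lt/(_ _ ep); apply: filterS => n fn.
  rewrite ger0_norm ?powR_ge0//.
  rewrite -[ltRHS](powRVK (lt0r_neq0 p0) (ltW e0)).
  by rewrite gt0_ltr_powR// ?nnegrE ?powR_ge0.
apply: (@continuous_cvg _ _ _ _ _ _ (fun x : R => x `^ p)); last exact: cvg_norm.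
apply: differentiable_continuous; apply/derivable1_diffP.
by apply: derivable_powR; rewrite in_itv/= andbT normr_gt0.
Qed.

Lemma cvg_power_sum F p (f : nat -> G -> R) u : 0 < p ->
  (forall x, f n x @[n --> \oo] --> u x) ->
  \sum_(x <- F) `|f n x| `^ p @[n --> \oo] --> \sum_(x <- F) `|u x| `^ p.
Proof.
by move=> p0 fu; apply: cvg_bigsum => x; exact: cvg_powR_norm.
Qed.

Lemma esum_ge_fset F (f : G -> R) :
  ((\sum_(x <- F) f x)%:E <= \esum_(x in [set: G]) (f x)%:E)%E.
Proof.
apply: esum_ge; exists [set` F]; first by split.
by rewrite -fsbig_seq ?fset_uniq// sumEFin.
Qed.

Lemma esum_le_fset (f : G -> R) (c : R) :
  (forall F, \sum_(x <- F) f x <= c) ->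
  (\esum_(x in [set: G]) (f x)%:E <= c%:E)%E.
Proof.
move=> H; apply: ge_ereal_sup => _ [X [finX _] <-].
by rewrite fsbig_finite//= sumEFin lee_fin.
Qed.

(** A substitute for Minkowski's inequality, sufficient because constants are
    free. *)
Lemma powR_add_le p (a b : R) : 0 <= p -> 0 <= a -> 0 <= b ->
  (a + b) `^ p <= 2 `^ p * (a `^ p + b `^ p).
Proof.
move=> p0; wlog ab : a b / a <= b => [H a0 b0|a0 b0].
  have [ab|/ltW ab] := leP a b; first exact: H.
  by rewrite addrC [X in _ * X]addrC; exact: H.
apply: (@le_trans _ _ ((2 * b) `^ p)).
  by rewrite ge0_ler_powR ?nnegrE ?addr_ge0 ?mulr_ge0//; lra.
by rewrite powRM// ler_pM2l ?powR_gt0// lerDr powR_ge0.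
Qed.

Lemma poweR_le_inv (X : \bar R) (e p : R) : 0 < p -> 0 <= e -> (0 <= X)%E ->
  (X `^ p^-1 <= e%:E -> X <= (e `^ p)%:E)%E.
Proof.
move=> p0 e0 X0 Xe.
rewrite -[leLHS]poweRe1// -(mulVf (lt0r_neq0 p0)) poweRrM -poweR_EFin.
apply: gt0_ler_poweR => //; first exact: ltW.
  by rewrite in_itv/= poweR_ge0 leey.
by rewrite in_itv/= lee_fin e0 leey.
Qed.

Context (K : finType) (T : K -> (G -> R) -> G -> R)
  (fs_T : forall k v, finitely_supported v -> finitely_supported (T k v))
  (T_sub : forall k v w x, T k (v \- w)%R x = T k v x - T k w x)
  (cvg_T : forall k (v : nat -> G -> R) u,
    (forall x, v n x @[n --> \oo] --> u x) ->
    forall x, T k (v n) x @[n --> \oo] --> T k u x).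

(** The common form of the two norms: one operator, the Laplacian, for the
    first; the m^2 second differences for the second. *)
Definition family_norm p u : \bar R :=
  ((\sum_k \esum_(x in [set: G]) (`|T k u x| `^ p)%:E) `^ p^-1)%E.

Lemma family_sum_ge0 p u :
  (0 <= \sum_k \esum_(x in [set: G]) (`|T k u x| `^ p)%:E)%E.
Proof.
by apply: sume_ge0 => k _; apply: esum_ge0 => x _; rewrite lee_fin powR_ge0.
Qed.

Lemma fset_family_sum_le p u (F : {fset G}) :
  ((\sum_k \sum_(x <- F) `|T k u x| `^ p)%:E <=
   \sum_k \esum_(x in [set: G]) (`|T k u x| `^ p)%:E)%E.
Proof. by rewrite -sumEFin; apply: lee_sum => k _; exact: esum_ge_fset. Qed.

(** Let v n be a Cauchy sequence tending to u pointwise.  On a finite set the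
    energy of v i - v j passes to the limit in j, so that v i - u has small
    energy; [powR_add_le] then bounds the energy of v i by that of u, up to the
    factor 2^p.  The bound for v i is restricted to a finite set F, passed to
    the limit in i, and finally the supremum over F is taken. *)
Lemma bound_on_completion p q : 1 <= p -> 0 < q ->
  (exists2 C : R, 0 <= C & forall v, finitely_supported v ->
    power_sum q v `^ q^-1 <= C * (\sum_k power_sum p (T k v)) `^ p^-1) ->
  exists C : R, forall u, completion0 (family_norm p) u ->
    (lp_norm q u <= C%:E * family_norm p u)%E.
Proof.
move=> p1 q0 [C0 C00 HC0]; have p0 : 0 < p by lra.
(* A positive constant keeps the right side infinite when the norm of u is
   infinite. *)
pose C := C0 + 1; have C_gt0 : 0 < C by rewrite /C; lra.
have HC v : finitely_supported v ->
    power_sum q v `^ q^-1 <= C * (\sum_k power_sum p (T k v)) `^ p^-1.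
  by move=> /HC0/le_trans; apply; rewrite ler_wpM2r ?powR_ge0// /C; lra.
exists (2 * C) => u [v [fv cauchy_v vu]].
have C2 : 0 < 2 * C by lra.
have Xge := family_sum_ge0 p u.
rewrite /family_norm; set X := (\sum_k _)%E in Xge *.
have [Xy|Xy] := eqVneq X +oo%E.
  rewrite Xy poweRyr ?invr_eq0 ?gt_eqF// gt0_muley ?lte_fin//.
  exact: leey.
have Xfin : X \is a fin_num by rewrite ge0_fin_numE// ltey.
have [x XE] : exists x, X = x%:E by exists (fine X); rewrite fineK.
have x0 : 0 <= x by rewrite -lee_fin -XE.
rewrite XE poweR_EFin -EFinM.
have key (d : R) : 0 < d -> forall F,
    (\sum_(y <- F) `|u y| `^ q) `^ q^-1 <= 2 * C * (x + d) `^ p^-1.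
  move=> d0 F.
  have [n0 Hn0] := cauchy_v _ (powR_gt0 p^-1 d0).
  have Hi i : (n0 <= i)%N -> \sum_k power_sum p (T k (v i)) <= 2 `^ p * (x + d).
    move=> n0i.
    have /choice[FK HFK] := fun k => supp_fset (fs_T k (fv i)).
    pose F0 := (\bigcup_(k <- enum K) FK k)%fset.
    have HF0 k y : y \notin F0 -> `|T k (v i) y| `^ p = 0.
      move=> yF; suff -> : T k (v i) y = 0 by rewrite normr0 powR0 ?gt_eqF.
      apply/eqP; rewrite -[_ == _]negbK -HFK.
      by apply: contra yF => yk; apply/bigfcupP; exists k; rewrite ?mem_enum.
    have E1 : \sum_k \sum_(y <- F0) `|T k u y| `^ p <= x.
      by rewrite -lee_fin -XE; exact: fset_family_sum_le.
    have E2 : \sum_k \sum_(y <- F0) `|T k (v i) y - T k u y| `^ p <= d.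
      have cv :
          \sum_k \sum_(y <- F0) `|T k (v i) y - T k (v j) y| `^ p @[j --> \oo] -->
          \sum_k \sum_(y <- F0) `|T k (v i) y - T k u y| `^ p.
        apply: cvg_bigsum => k.
        apply: (cvg_power_sum (f := fun j y => T k (v i) y - T k (v j) y)
          (u := fun y => T k (v i) y - T k u y)) => // y.
        by apply: cvgB; [exact: cvg_cst|exact: cvg_T].
      apply: (cvgr_to_le cv); exists n0 => // j /= n0j.
      have := ltW (Hn0 i j n0i n0j).
      move=> /(poweR_le_inv p0 (powR_ge0 _ _) (family_sum_ge0 _ _)).
      move=> /(le_trans (fset_family_sum_le _ _ F0)).
      rewrite lee_fin -powRrM mulVf ?gt_eqF// powRr1 ?(ltW d0)//.
      apply: le_trans; rewrite le_eqVlt; apply/orP; left; apply/eqP.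
      by apply: eq_bigr => k _; apply: eq_bigr => y _; rewrite T_sub.
    have H2p : 0 < 2 `^ p :> R by exact: powR_gt0.
    apply: (@le_trans _ _ (2 `^ p * (\sum_k \sum_(y <- F0) `|T k u y| `^ p +
        \sum_k \sum_(y <- F0) `|T k (v i) y - T k u y| `^ p))); last first.
      by rewrite ler_pM2l//; exact: lerD.
    rewrite -big_split/= mulr_sumr; apply: ler_sum => k _.
    rewrite /power_sum (tsumE (F := F0))//; last exact: HF0.
    rewrite -big_split/= mulr_sumr; apply: ler_sum => y _.
    apply: le_trans (powR_add_le (ltW p0) (normr_ge0 _) (normr_ge0 _)).
    rewrite ge0_ler_powR ?(ltW p0) ?nnegrE ?addr_ge0//.
    by rewrite (le_trans _ (ler_normD _ _))// addrC subrK.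
  have B0 : 0 <= 2 * C * (x + d) `^ p^-1 by rewrite mulr_ge0 ?powR_ge0// ltW.
  have Hq i : (n0 <= i)%N ->
      \sum_(y <- F) `|v i y| `^ q <= (2 * C * (x + d) `^ p^-1) `^ q.
    move=> n0i.
    have fvi := fs_powR q0 (fv i).
    apply: (@le_trans _ _ (power_sum q (v i))).
      by apply: sum_le_tsum => // y; exact: powR_ge0.
    rewrite -powR_inv_le ?power_sum_ge0//.
    apply: (le_trans (HC _ (fv i))).
    rewrite [2 * C]mulrC -mulrA ler_pM2l//.
    apply: (@le_trans _ _ ((2 `^ p * (x + d)) `^ p^-1)).
      have S0 : 0 <= \sum_k power_sum p (T k (v i)).
        by apply: sumr_ge0 => k _; exact: power_sum_ge0.
      rewrite ge0_ler_powR ?nnegrE ?invr_ge0 ?(ltW p0)//; last exact: Hi.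
      by apply: mulr_ge0; [exact: powR_ge0|lra].
    rewrite powRM ?powR_ge0//; last by lra.
    by rewrite -powRrM divff ?gt_eqF// powRr1.
  have cv := cvg_power_sum (F := F) q0 vu.
  have Sq : \sum_(y <- F) `|u y| `^ q <= (2 * C * (x + d) `^ p^-1) `^ q.
    by apply: (cvgr_to_le cv); exists n0 => // i /= n0i; exact: Hq.
  by rewrite powR_inv_le// sumr_ge0// => y _; exact: powR_ge0.
have B0 : 0 <= 2 * C * x `^ p^-1 by rewrite mulr_ge0 ?powR_ge0// ltW.
(* Let d tend to 0, after solving the inequality for x + d. *)
have key0 F : (\sum_(y <- F) `|u y| `^ q) `^ q^-1 <= 2 * C * x `^ p^-1.
  set Z := _ `^ q^-1.
  have Z0 : 0 <= Z / (2 * C) by rewrite divr_ge0 ?powR_ge0// ltW.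
  rewrite mulrC -ler_pdivrMr//.
  have pV0 : 0 < p^-1 by rewrite invr_gt0.
  rewrite -powR_inv_le// invrK; apply/ler_addgt0Pr => d d0.
  rewrite -[p]invrK powR_inv_le//; last by lra.
  by rewrite ler_pdivrMr// mulrC; exact: key.
rewrite /lp_norm; set B := 2 * C * _ in B0 key0 *.
have qV0 : 0 < q^-1 by rewrite invr_gt0.
have -> : B = (B `^ q) `^ q^-1 by rewrite -{1}[q]invrK powRVK ?gt_eqF.
rewrite -poweR_EFin; apply: gt0_ler_poweR; first exact: ltW.
- by rewrite in_itv/= leey andbT; apply: esum_ge0 => y _; rewrite lee_fin powR_ge0.
- by rewrite in_itv/= leey andbT lee_fin powR_ge0.
apply: esum_le_fset => F.
by rewrite -powR_inv_le// sumr_ge0// => y _; exact: powR_ge0.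
Qed.

End Completion.

(** * The two inequalities on the completed spaces *)

Section NormsAsFamilies.
Context {G : groupType} {R : realType} {m : nat} (S : m.-tuple G).
Implicit Types (p : R) (u v w : G -> R).

Lemma partial_diffB i v w x :
  partial_diff S i (v \- w)%R x = partial_diff S i v x - partial_diff S i w x.
Proof. by rewrite /partial_diff /=; ring. Qed.

Lemma cvg_partial_diff i (v : nat -> G -> R) u :
  (forall x, v n x @[n --> \oo] --> u x) ->
  forall x, partial_diff S i (v n) x @[n --> \oo] --> partial_diff S i u x.
Proof. by move=> vu x; apply: cvgB; exact: vu. Qed.

Lemma laplacianB v w x : uniq S ->
  laplacian S (v \- w)%R x = laplacian S v x - laplacian S w x.
Proof.
move=> S_uniq; rewrite !laplacianE// -sumrB.
by apply: eq_bigr => i _; exact: partial_diffB.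
Qed.

Lemma cvg_laplacian (v : nat -> G -> R) u : uniq S ->
  (forall x, v n x @[n --> \oo] --> u x) ->
  forall x, laplacian S (v n) x @[n --> \oo] --> laplacian S u x.
Proof.
move=> S_uniq vu x; rewrite laplacianE//.
under eq_fun do rewrite laplacianE//.
by apply: cvg_bigsum => i; exact: cvg_partial_diff.
Qed.

Lemma D2_norm_family p :
  D2_norm S p = family_norm (fun (_ : 'I_1) u => laplacian S u) p.
Proof. by apply/funext => u; rewrite /family_norm big_ord1. Qed.

Lemma tildeD2_norm_family p : tildeD2_norm S p =
  family_norm (fun ij : 'I_m * 'I_m =>
    fun u => partial_diff S ij.2 (partial_diff S ij.1 u)) p.
Proof. by apply/funext => u; rewrite /tildeD2_norm pair_big. Qed.

End NormsAsFamilies.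

Lemma sobolev_exp2_gt0 (R : realType) N (p : R) :
  1 <= p -> p < N%:R / 2 -> 0 < sobolev_exp2 N p.
Proof. by move=> p1 pN; rewrite divr_gt0 ?mulr_gt0//; lra. Qed.

Theorem theorem10 (R : realType) (G : groupType) (m : nat) (S : m.-tuple G)
    (N : nat) (S_uniq : uniq S) (S_sym : symmetric_set S)
    (S_gen : generating_set S) (S_growth : polynomial_growth S R N)
    (N_ge3 : (3 <= N)%N) :
  (forall p : R, 1 < p -> p < N%:R / 2 ->
     exists C : R, forall u : G -> R, D20 S p u ->
       (lp_norm (sobolev_exp2 N p) u <= C%:E * D2_norm S p u)%E) /\
  (forall p : R, 1 <= p -> p < N%:R / 2 ->
     exists C : R, forall u : G -> R, tildeD20 S p u ->
       (lp_norm (sobolev_exp2 N p) u <= C%:E * tildeD2_norm S p u)%E).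
Proof.
split=> p p1 pN.
  have [K K0 HK] := laplacian_bound S_uniq S_sym S_growth p1 pN.
  rewrite /D20 D2_norm_family.
  apply: bound_on_completion => //.
  - by move=> _ v; exact: fs_laplacian.
  - by move=> _ v w x; exact: laplacianB.
  - by move=> _ v u; exact: cvg_laplacian.
  - exact: ltW.
  - by apply: sobolev_exp2_gt0 => //; exact: ltW.
  by exists K => // v fv; rewrite big_ord1; exact: HK.
have [K K0 HK] := hessian_bound S_growth p1 pN.
rewrite /tildeD20 tildeD2_norm_family.
apply: bound_on_completion => //.
- by move=> ij v fv; do 2!apply: fs_partial_diff.
- move=> ij v w x; rewrite -partial_diffB; congr (partial_diff S _ _ x).
  by apply/funext => y; exact: partial_diffB.
- by move=> ij v u vu; do 2!apply: cvg_partial_diff.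
- exact: sobolev_exp2_gt0.
exists K => // v fv; rewrite -(pair_big xpredT xpredT
  (fun i j => power_sum p (partial_diff S j (partial_diff S i v)))).
exact: HK.
Qed.
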